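(* For every fixed integer $\pi\ge 0$ there is a constant $c_\pi$ such that the following holds for all integers $m,n\ge1$ and every minimal $m\times n$ matrix $A$ with $0/1$ entries. Let $$\mathcal{F}_A=\{x\in\mathbb{R}^n:\ x_i^2-x_i=0\ \ \forall i\in\{1,\dots,n\},\ Ax\ge e\}$$ be the feasible region of the set cover problem given by $A$, where $e$ is the all-ones vector. Then $|\mathcal{S}_A(\pi)|\le c_\pi (mn)^{c_\pi}$, and the $\mathcal{S}_A(\pi)$-SoS relaxation of $\mathcal{F}_A$ satisfies all valid inequalities for $\mathcal{F}_A$ of pitch at most $\pi$. That is, for every inequality $a^\top x-a_0\ge0$ with $a\ge0$ that is valid for all $x\in\mathcal{F}_A$ and has pitch at most $\pi$, every feasible solution $y$ of the $\mathcal{S}_A(\pi)$-SoS relaxation satisfies $\sum_{i=1}^n a_i\,y[x_i]-a_0\ge0$.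
   Context: **Minimality.** Let $A_i\subseteq[n]=\{1,\dots,n\}$ be the support of row $i$ of $A$. The matrix $A$ is minimal if there are no $i\ne j$ with $A_i\subseteq A_j$. **Pitch.** For an inequality $a^\top x-a_0\ge0$ with indices ordered so that $0<a_1\le a_2\le\dots\le a_h$ and $a_j=0$ for $j>h$, its pitch is the minimum integer $p\ge 0$ such that $\sum_{i=1}^{p}a_i-a_0\ge0$. **Relaxation.** For $p\in\mathbb{R}[x_1,\dots,x_n]$, $\overline{p}$ is its multilinear form (replace each $x_i^k$, $k\ge2$, by $x_i$). Put $x_0:=1$. For a finite set $\mathcal{S}$ of multilinear polynomials with span $\langle\mathcal{S}\rangle$, let $T:=\{\overline{x_i p q}:p,q\in\mathcal{S},\ 0\le i\le n\}$. The feasible solutions of the $\mathcal{S}$-SoS relaxation of a set $\{x\in\mathbb{R}^n:x_i^2-x_i=0\ \forall i,\ g_j(x)\ge0\ \forall j\}$ with linear $g_j$ are the linear functionals $y:\langle T\rangle\to\mathbb{R}$ with $y[1]=1$, $y[\overline{q^2}]\ge0$ and $y[\overline{q^2g_j}]\ge0$ for all $q\in\langle\mathcal{S}\rangle$ and all $j$. For $\mathcal{F}_A$ the constraints $g_j\ge0$ are the rows of $Ax-e\ge0$ together with $x_i\ge0$ for $i\in[n]$. **Kronecker delta polynomials.** For $I\subseteq Z\subseteq[n]$, $\delta^Z_I:=\prod_{i\in I}x_i\prod_{j\in Z\setminus I}(1-x_j)$, with $\delta^\emptyset_\emptyset=1$. **Restricted matrices.** For disjoint $T,F\subseteq[n]$,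 $A_{(T,F)}$ is the matrix obtained from $A$ by removing every row whose support meets $T$, setting to zero the columns with index in $F$, and then removing dominated rows (a row whose support contains the support of another remaining row, keeping one copy of equal rows), so that $A_{(T,F)}$ is minimal. Columns keep their indices. **The set $\mathcal{S}_A(\pi)$.** Let $\mathcal{C}(\pi)$ be the family of all sets $C$ of row indices of $A$ with $|C|\le\pi$, and for $C\in\mathcal{C}(\pi)$ let $V_C:=\bigcup_{i,j\in C,\,i\neq j}(A_i\cap A_j)$. Define recursively $\mathcal{S}_A(0):=\{1\}$ and, for $\pi\ge1$, let $\mathcal{S}_A(\pi)$ consist of the following polynomials: 1. $\delta_\emptyset^{V_C}$ for $C\in\mathcal{C}(\pi)$; 2. $\delta_J^{V_C}\cdot q$ for $C\in\mathcal{C}(\pi)$, $J\subseteq V_C$ with $0<|J|<\pi$, and $q\in\mathcal{S}_{A_{(J,V_C\setminus J)}}(\pi-|J|)$; 3. $\sum_{J\subseteq V_C\setminus H,\ |J|=k}\delta^{V_C}_{I\cup J}$ for $C\in\mathcal{C}(\pi)$, $H\subseteq V_C$ with $|H|\le\pi$, $I\subseteq H$, and integers $k$ with $\pi-|I|\le k\le|V_C|$. *)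

(* Defs.v *)
From HB Require Import structures.
From mathcomp Require Import all_boot all_order all_algebra.
From mathcomp Require Import finmap reals.
From mathcomp.multinomials Require Import mpoly.

Set Implicit Arguments.
Unset Strict Implicit.
Unset Printing Implicit Defensive.

Import Order.TTheory GRing.Theory Num.Theory.
Local Open Scope ring_scope.

Section Matrices.
Variables (R : realType) (n : nat).

Definition supp m (A : 'M[R]_(m, n)) (i : 'I_m) : {set 'I_n} :=
  [set j | A i j != 0].

Definition zero_one m (A : 'M[R]_(m, n)) : Prop :=
  forall i j, A i j = 0 \/ A i j = 1.

Definition minimal m (A : 'M[R]_(m, n)) : Prop :=
  forall i j, i != j -> ~~ (supp A i \subset supp A j).

Definition keep_rows m (A : 'M[R]_(m, n)) (P : {set 'I_m}) : 'M[R]_(#|P|, n) :=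
  \matrix_(i < #|P|, j < n) A (enum_val i) j.

Definition zero_cols m (A : 'M[R]_(m, n)) (F : {set 'I_n}) : 'M[R]_(m, n) :=
  \matrix_(i, j) if j \in F then 0 else A i j.

(* Among rows with equal supports, the one of least index is kept. *)
Definition undominated m (A : 'M[R]_(m, n)) : {set 'I_m} :=
  [set i | [forall k, (k != i) && (supp A k \subset supp A i) ==>
                      (supp A k == supp A i) && (i < k)%N]].

Definition remove_dominated m (A : 'M[R]_(m, n)) :=
  keep_rows A (undominated A).

Definition restrict m (A : 'M[R]_(m, n)) (T F : {set 'I_n}) :=
  remove_dominated
    (zero_cols (keep_rows A [set i | [disjoint supp A i & T]]) F).

Definition feasible m (A : 'M[R]_(m, n)) (x : 'cV[R]_n) : Prop :=
  (forall i, x i 0 ^+ 2 - x i 0 = 0) /\ (forall i, 1 <= (A *m x) i 0).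

Definition valid m (A : 'M[R]_(m, n)) (a : 'cV[R]_n) (a0 : R) : Prop :=
  forall x : 'cV[R]_n, feasible A x -> 0 <= \sum_i a i 0 * x i 0 - a0.

Definition sorted_coefs (a : 'cV[R]_n) : seq R :=
  sort <=%R [seq a i 0 | i <- enum 'I_n & 0 < a i 0].

(* The sum of the p smallest positive coefficients, minus a0; for p larger than
   the number h of positive coefficients, a_{h+1}, ..., a_p count as 0. *)
Definition pitch_slack (a : 'cV[R]_n) (a0 : R) (p : nat) : R :=
  \sum_(0 <= i < p) (sorted_coefs a)`_i - a0.

(* A relation, since no such p exists when a0 exceeds the sum of all
   coefficients (which a valid inequality allows only if nothing is feasible). *)
Definition is_pitch (a : 'cV[R]_n) (a0 : R) (p : nat) : Prop :=
  0 <= pitch_slack a a0 p /\ forall k, 0 <= pitch_slack a a0 k -> (p <= k)%N.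

End Matrices.

Section Relaxation.
Variables (R : realType) (n : nat).

Definition mlin (p : {mpoly R[n]}) : {mpoly R[n]} :=
  \sum_(m <- msupp p) p@_m *: 'X_[ [multinom minn (m i) 1 | i < n] ].

Definition in_span (S : {fset {mpoly R[n]}}) (p : {mpoly R[n]}) : Prop :=
  exists c : {mpoly R[n]} -> R, p = \sum_(q <- S) c q *: q.

(* The variable x_i, with None standing for the index 0, i.e. x_0 = 1. *)
Definition xvar (i : option 'I_n) : {mpoly R[n]} :=
  if i is Some j then 'X_j else 1.

Definition products (S : {fset {mpoly R[n]}}) : {fset {mpoly R[n]}} :=
  (\bigcup_(p <- S) \bigcup_(q <- S)
     [fset mlin (xvar i * p * q) | i : option 'I_n])%fset.

Definition linear_on_span (T : {fset {mpoly R[n]}}) (y : {mpoly R[n]} -> R) :=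
  forall (a : R) (p q : {mpoly R[n]}), in_span T p -> in_span T q ->
    y (a *: p + q) = a * y p + y q.

(* The functional y lives on the span of T := products S; it is represented by
   a function on all polynomials whose values outside that span are never
   used (all the arguments of y below lie in it when the g k are affine). *)
Definition sos_solution (S : {fset {mpoly R[n]}})
    (K : Type) (g : K -> {mpoly R[n]}) (y : {mpoly R[n]} -> R) : Prop :=
  [/\ linear_on_span (products S) y,
      y 1 = 1,
      forall q, in_span S q -> 0 <= y (mlin (q ^+ 2)) &
      forall q k, in_span S q -> 0 <= y (mlin (q ^+ 2 * g k))].

Definition cover_constraints m (A : 'M[R]_(m, n)) (k : 'I_m + 'I_n) :
    {mpoly R[n]} :=
  match k with
  | inl i => \sum_j A i j *: 'X_j - 1
  | inr j => 'X_j
  end.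

End Relaxation.

Section Polynomials.
Variables (R : realType) (n : nat).

Definition delta (Z I : {set 'I_n}) : {mpoly R[n]} :=
  \prod_(i in I) 'X_i * \prod_(j in Z :\: I) (1 - 'X_j).

Definition row_sets (m pi : nat) : {set {set 'I_m}} :=
  [set C : {set 'I_m} | (#|C| <= pi)%N].

Definition overlap m (A : 'M[R]_(m, n)) (C : {set 'I_m}) : {set 'I_n} :=
  [set v | [exists i in C, exists j in C,
             (i != j) && (v \in supp A i :&: supp A j)]].

Definition sym_delta (V H I : {set 'I_n}) (k : nat) : {mpoly R[n]} :=
  \sum_(J : {set 'I_n} | (J \subset V :\: H) && (#|J| == k)) delta V (I :|: J).

(* At pi = p.+1 the recursive call is made at pi - #|J|, written p - #|J|.-1
   (equal for 0 < #|J|) so that the recursion on pi is structural. *)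
Fixpoint SA (pi m : nat) (A : 'M[R]_(m, n)) {struct pi} :
    {fset {mpoly R[n]}} :=
  match pi with
  | 0 => [fset 1]%fset
  | p.+1 =>
    (\bigcup_(C in row_sets m p.+1)
       (let V := overlap A C in
        [fset delta V set0]
        `|` \bigcup_(J in powerset V | (0 < #|J| < p.+1)%N)
              [fset delta V J * q |
                 q in SA (p - #|J|.-1) (restrict A J (V :\: J))]
        `|` \bigcup_(H in powerset V | (#|H| <= p.+1)%N)
            \bigcup_(I in powerset H)
              [fset sym_delta V H I (val k) |
                 k : 'I_#|V|.+1 & (p.+1 - #|I| <= k)%N]))%fset
  end.

End Polynomials.

(* Main.v *)
Require Import Defs.
From mathcomp Require Import all_boot all_order all_algebra.
From mathcomp Require Import finmap reals.
From mathcomp.multinomials Require Import mpoly.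
From mathcomp Require Import ring zify.
Import Order.TTheory GRing.Theory Num.Theory.
Local Open Scope ring_scope.

Set Implicit Arguments.
Unset Strict Implicit.
Unset Printing Implicit Defensive.

(** Modulo the relations x_i^2 = x_i a polynomial is a function on the subsets K
    of the index set, and its multilinear form is the interpolation of that
    function ([mlinE]). An inequality a x >= a0 is therefore settled by writing
    the function K |-> a(K) - a0 as a nonnegative combination of functions on
    which y is nonnegative by the conditions of the relaxation. These functions
    form a convex cone, [certified]. It contains the indicator of an event,
    and its products with a coordinate or with a row constraint, as soon as the
    indicator is the function of a member of the family S.

    The argument is an induction on pi. Nonnegativity of y on the coordinates
    settles a0 <= 0, and the constraint -1 >= 0 of an empty row settles the
    infeasible case. Otherwise there is a set C of at most pi rows, all inside
    the support of a, with nonnegative weights w such that w i <= a j whenever j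
    lies in row i, and with total weight at least a0 ([exists_critical_rows]). Let V be the union of the pairwise intersections
    of these rows, and split according to the trace J of K on V:

    - J is empty. Off V the rows of C are disjoint, so the sum of their
      constraints with weights w is dominated by a x - a0
      ([certified_empty_trace]).

    - 0 < #|J| < pi. Fixing x to 1 on J and to 0 on V \ J leaves a set cover
      problem for the restricted matrix, and the inequality becomes one of
      pitch at most pi - #|J|. The functional p |-> y(delta_J p) solves the
      corresponding relaxation, because the family for pi contains delta_J q
      for every q of the smaller family; the induction hypothesis applies
      ([certified_trace]).

    - #|J| >= pi. There are too many such J to treat one at a time, but for
      fixed #|J| = k the function a(K) - a0 depends, up to nonnegative
      multiples of single coordinates, only on the trace of K on the pi smallest
      weights of V. This is a combination of the symmetric sums of the third
      kind, and its coefficients are nonnegative by the pitch condition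
      ([certified_slice]).

    The pitch enters only through this consequence: every set of at least pi
    indices of the support of a has total weight at least a0 ([pitch_le_sum]).

    For the size, one level of the recursion chooses a set of at most pi rows, a
    set of at most pi columns and possibly a subset of it, and an integer k <= n;
    each choice is polynomial in m and n, and there are at most pi levels
    ([card_SA_le]). *)

(** * Polynomials as functions on the cube *)

Section Cube.
Variables (R : realType) (n : nat).
Implicit Types (p q : {mpoly R[n]}) (I J K V H Z : {set 'I_n}).
Implicit Types f g : {set 'I_n} -> R.

Definition cube_eval p K : R := p.@[fun i => (i \in K)%:R].

Definition interpolant f : {mpoly R[n]} := \sum_K f K *: delta R setT K.

Lemma cube_eval1 K : cube_eval 1 K = 1.
Proof. exact: rmorph1. Qed.

Lemma cube_evalB p q K : cube_eval (p - q) K = cube_eval p K - cube_eval q K.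
Proof. exact: mevalB. Qed.

Lemma cube_evalM p q K : cube_eval (p * q) K = cube_eval p K * cube_eval q K.
Proof. exact: rmorphM. Qed.

Lemma cube_evalX2 p K : cube_eval (p ^+ 2) K = cube_eval p K ^+ 2.
Proof. exact: rmorphXn. Qed.

Lemma cube_evalZ c p K : cube_eval (c *: p) K = c * cube_eval p K.
Proof. exact: mevalZ. Qed.

Lemma cube_eval_sum (T : Type) (r : seq T) (P : pred T) (F : T -> {mpoly R[n]}) K :
  cube_eval (\sum_(i <- r | P i) F i) K =
  \sum_(i <- r | P i) cube_eval (F i) K.
Proof. exact: raddf_sum. Qed.

Lemma cube_evalX i K : cube_eval 'X_i K = (i \in K)%:R.
Proof. exact: mevalXU. Qed.

Lemma cube_eval_delta V J K : J \subset V ->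
  cube_eval (delta R V J) K = (K :&: V == J)%:R.
Proof.
move=> JV; rewrite /delta cube_evalM /cube_eval !rmorph_prod /=.
under eq_bigr do rewrite mevalXU.
under [X in _ * X]eq_bigr do rewrite mevalB meval1 mevalXU.
case: eqVneq => [KVJ|KVJ].
- rewrite !big1 ?mulr1 // => i; rewrite -KVJ !inE;
    by case: (i \in K); case: (i \in V); rewrite ?subr0.
- case: (boolP (J \subset K)) => [JK|/subsetPn[i iJ iK]]; last first.
    by rewrite (bigD1 i) //= (negPf iK) !mul0r.
  have: ~~ (K :&: V \subset J).
    by apply: contra KVJ => h; rewrite eqEsubset h subsetI JK.
  case/subsetPn=> i; rewrite inE => /andP[iK iV] iJ.
  by rewrite [X in _ * X](bigD1 i) ?inE ?iJ //= iK subrr mul0r mulr0.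
Qed.

Lemma cube_eval_interpolant f K : cube_eval (interpolant f) K = f K.
Proof.
rewrite cube_eval_sum (bigD1 K) //= big1 => [|J /negPf JK].
  by rewrite cube_evalZ cube_eval_delta ?subsetT // setIT eqxx mulr1 addr0.
by rewrite cube_evalZ cube_eval_delta ?subsetT // setIT eq_sym JK mulr0.
Qed.

Lemma eq_interpolant f g : f =1 g -> interpolant f = interpolant g.
Proof. by move=> fg; apply: eq_bigr => K _; rewrite fg. Qed.

Lemma interpolant_comb (c : R) f g :
  interpolant (fun K => c * f K + g K) = c *: interpolant f + interpolant g.
Proof.
rewrite /interpolant scaler_sumr -big_split; apply: eq_bigr => K _ /=.
by rewrite scalerDl scalerA.
Qed.

(** By linearity it is enough to treat a monomial. Expanding the product of the
    factors [x_i + (1 - x_i)] over the variables missing from it writes its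
    squarefree part as the sum of the [delta setT K] over the sets [K] that
    contain its support. *)
Lemma mlinE p : mlin p = interpolant (cube_eval p).
Proof.
transitivity (\sum_(m <- msupp p) p@_m *:
    \sum_(K : {set 'I_n}) (\prod_(i < n) (i \in K)%:R ^+ m i) *: delta R setT K); last first.
  under eq_bigr do rewrite scaler_sumr.
  rewrite exchange_big; apply: eq_bigr => K _.
  rewrite /cube_eval mevalE scaler_suml; apply: eq_bigr => m _.
  by rewrite scalerA.
apply: eq_bigr => m _; congr (_ *: _).
rewrite mpolyXE_id.
transitivity (\prod_(i < n) ('X_i + (1 - 'X_i) * (m i == 0)%:R : {mpoly R[n]})).
  apply: eq_bigr => i _; rewrite mnmE.
  by case: (m i) => [|k]; rewrite ?minn0 ?minnSS ?minn0 /=; ring.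
rewrite bigA_distr /=; apply: eq_big => // K _.
rewrite /delta -[in RHS]mul_mpolyC rmorph_prod /=.
rewrite [\prod_(i in K) _]big_mkcond [\prod_(i in setT :\: K) _]big_mkcond.
rewrite -!big_split; apply: eq_bigr => i _ /=.
rewrite !inE; case: (i \in K) => /=; first by rewrite expr1n mpolyC1; ring.
by case: (m i) => [|k] /=; rewrite ?expr0 ?expr0n ?mpolyC1 ?mpolyC0; ring.
Qed.

Lemma mlinX i : mlin 'X_i = 'X_i :> {mpoly R[n]}.
Proof.
rewrite /mlin msuppX big_seq1 mcoeffX eqxx scale1r; congr 'X_[_].
by apply/mnmP => j; rewrite mnmE mnm1E; case: eqP.
Qed.

Lemma mlin1 : mlin 1 = 1 :> {mpoly R[n]}.
Proof.
rewrite -mpolyX0 /mlin msuppX big_seq1 mcoeffX eqxx scale1r; congr 'X_[_].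
by apply/mnmP => j; rewrite mnmE mnm0E min0n.
Qed.

Lemma eq_mlin p q : cube_eval p =1 cube_eval q -> mlin p = mlin q.
Proof. by move=> pq; rewrite !mlinE; apply: eq_interpolant. Qed.

Lemma cube_eval_mlin p K : cube_eval (mlin p) K = cube_eval p K.
Proof. by rewrite mlinE cube_eval_interpolant. Qed.

(** For given [K] at most one [J] contributes, namely [K :&: V :\: H]: the sum is
    the indicator of an event, hence idempotent on the cube. *)
Lemma cube_eval_sym_delta V H I k K : I \subset H -> H \subset V ->
  cube_eval (sym_delta R V H I k) K =
  ((K :&: H == I) && (#|K :&: V| == #|I| + k)%N)%:R.
Proof.
move=> IH HV.
have cIJ J : J \subset V :\: H -> #|I :|: J| = (#|I| + #|J|)%N.
  rewrite subsetD => /andP[_ JH]; rewrite cardsU; suff -> : I :&: J = set0.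
    by rewrite cards0 subn0.
  by apply/setP=> i; rewrite !inE; apply: contraTF JH => /andP[/(subsetP IH) iH iJ];
     apply/pred0Pn; exists i; rewrite /= iJ iH.
have IJV J : J \subset V :\: H -> I :|: J \subset V.
  rewrite subsetD => /andP[JV _]; rewrite subUset JV andbT.
  exact: subset_trans IH HV.
rewrite /sym_delta cube_eval_sum.
under eq_bigr => J /andP[JVH _] do rewrite cube_eval_delta ?IJV //.
case: (boolP (_ && _)) => [/andP[/eqP KHI /eqP KV]|neq].
- have JVH : K :&: V :\: H \subset V :\: H by rewrite setSD ?subsetIr.
  have KVE : K :&: V = I :|: (K :&: V :\: H).
    by rewrite -KHI; apply/setP=> i; move: (introT implyP (subsetP HV i)); rewrite !inE;
       case: (i \in H); case: (i \in V); case: (i \in K).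
  rewrite (bigD1 (K :&: V :\: H)) /=; last first.
    by rewrite JVH; move: KV; rewrite {1}KVE cIJ // => /addnI ->; rewrite eqxx.
  rewrite -KVE eqxx big1 ?addr0 // => J /andP[/andP[JVH' _] JN].
  case: eqP => // KVJ; case/eqP: JN; rewrite KVJ.
  move: JVH'; rewrite subsetD => /andP[_ /pred0P JH].
  apply/setP=> i; move: (JH i) (introT implyP (subsetP IH i)); rewrite !inE /=.
  by case: (i \in J); case: (i \in I); case: (i \in H).
- rewrite big1 // => J /andP[JVH /eqP Jk]; case: eqP => // KVJ.
  case/negP: neq; rewrite KVJ cIJ // Jk eqxx andbT.
  move: JVH; rewrite subsetD => /andP[_ /pred0P JH].
  apply/eqP/setP=> i.
  have := congr1 (fun X : {set 'I_n} => i \in X) KVJ.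
  move: (JH i) (introT implyP (subsetP IH i)) (introT implyP (subsetP HV i)); rewrite !inE /=.
  by case: (i \in J); case: (i \in I); case: (i \in H); case: (i \in K);
     case: (i \in V).
Qed.

End Cube.

(** * Certified functions *)

Section Certified.
Variables (R : realType) (n : nat).
Implicit Types (S T : {fset {mpoly R[n]}}) (p q : {mpoly R[n]}).
Implicit Types (y : {mpoly R[n]} -> R) (f g : {set 'I_n} -> R).

Lemma in_span_mem T p : p \in T -> in_span T p.
Proof.
move=> pT; exists (fun q => (q == p)%:R).
rewrite (big_fsetD1 p) //= eqxx scale1r big_seq big1 ?addr0 // => q.
by rewrite !inE => /andP[/negPf -> _]; rewrite scale0r.
Qed.

Lemma in_span_comb T (c : R) p q :
  in_span T p -> in_span T q -> in_span T (c *: p + q).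
Proof.
move=> [a ->] [b ->]; exists (fun r => c * a r + b r).
rewrite scaler_sumr -big_split; apply: eq_bigr => r _ /=.
by rewrite scalerDl scalerA.
Qed.

Lemma in_span0 T : in_span T 0.
Proof. by exists (fun=> 0); rewrite big1 // => q _; rewrite scale0r. Qed.

Lemma in_span_sum T (I : Type) (r : seq I) (P : pred I) (F : I -> {mpoly R[n]}) :
  (forall i, P i -> in_span T (F i)) -> in_span T (\sum_(i <- r | P i) F i).
Proof.
move=> TF; apply: big_ind => //; first exact: in_span0.
by move=> p q Tp Tq; rewrite -[p]scale1r; apply: in_span_comb.
Qed.

Lemma mem_products S (i : option 'I_n) p q :
  p \in S -> q \in S -> mlin (xvar R i * p * q) \in products S.
Proof.
move=> pS qS; apply/bigfcupP; exists p; rewrite ?pS //.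
apply/bigfcupP; exists q; rewrite ?qS //.
by apply/imfsetP; exists i.
Qed.

Lemma productsP S p : p \in products S ->
  exists i q r, [/\ q \in S, r \in S & p = mlin (xvar R i * q * r)].
Proof.
case/bigfcupP=> q /andP[qS _] /bigfcupP[r /andP[rS _]] /imfsetP[i _ ->].
by exists i, q, r.
Qed.

(** The conditions on a solution, for the members of [S] and without
    normalisation. In this form they pass from [y] to the conditional functional
    [p |-> y (mlin (delta * p))], whose value at 1 may be any nonnegative number,
    zero included. *)
Definition relaxed_solution S (K : Type) (g : K -> {mpoly R[n]}) y : Prop :=
  [/\ linear_on_span (products S) y,
      forall q, q \in S -> 0 <= y (mlin (q ^+ 2)) &
      forall q k, q \in S -> 0 <= y (mlin (q ^+ 2 * g k))].

(** Stated for the interpolant rather than for a polynomial representing [f], so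
    that decompositions can be checked pointwise on the cube. *)
Definition certified S y f : Prop :=
  in_span (products S) (interpolant f) /\ 0 <= y (interpolant f).

Section Cone.
Variables (S : {fset {mpoly R[n]}}) (y : {mpoly R[n]} -> R).
Hypothesis ylin : linear_on_span (products S) y.

Lemma linear_on_span0 : y 0 = 0.
Proof.
have := ylin 1 (in_span0 (products S)) (in_span0 (products S)).
by rewrite scaler0 add0r mul1r => /esym; rewrite -[RHS]add0r => /addIr.
Qed.

Lemma certified_ext f g : certified S y f -> f =1 g -> certified S y g.
Proof. by rewrite /certified => + /eq_interpolant <-. Qed.

Lemma certified0 : certified S y (fun=> 0).
Proof.
rewrite /certified; have -> : interpolant (fun=> 0) = 0 :> {mpoly R[n]}.
  by rewrite /interpolant big1 // => K _; rewrite scale0r.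
by split; [exact: in_span0 | rewrite linear_on_span0].
Qed.

Lemma certified_comb (c : R) f g : 0 <= c ->
  certified S y f -> certified S y g -> certified S y (fun K => c * f K + g K).
Proof.
move=> c0 [Sf f0] [Sg g0]; rewrite /certified interpolant_comb.
by split; [exact: in_span_comb | rewrite ylin // addr_ge0 // mulr_ge0].
Qed.

Lemma certifiedD f g :
  certified S y f -> certified S y g -> certified S y (fun K => f K + g K).
Proof.
move=> cf cg; apply: certified_ext (certified_comb ler01 cf cg) _ => K.
by rewrite mul1r.
Qed.

Lemma certifiedZ (c : R) f : 0 <= c ->
  certified S y f -> certified S y (fun K => c * f K).
Proof.
move=> c0 cf; apply: certified_ext (certified_comb c0 cf certified0) _ => K.
by rewrite addr0.
Qed.

Lemma certified_sum (I : finType) (P : pred I) (F : I -> {set 'I_n} -> R) :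
  (forall i, P i -> certified S y (F i)) ->
  certified S y (fun K => \sum_(i | P i) F i K).
Proof.
move=> cF; rewrite /index_enum; elim: (Finite.enum I) => [|i r IHr].
  by apply: certified_ext certified0 _ => K; rewrite big_nil.
case: (boolP (P i)) => Pi; last first.
  by apply: certified_ext IHr _ => K; rewrite big_cons (negPf Pi).
by apply: certified_ext (certifiedD (cF _ Pi) IHr) _ => K; rewrite big_cons Pi.
Qed.

Lemma linear_on_span_sum (I : Type) (r : seq I) (a : I -> R)
    (F : I -> {mpoly R[n]}) :
  (forall i, in_span (products S) (F i)) ->
  y (\sum_(i <- r) a i *: F i) = \sum_(i <- r) a i * y (F i).
Proof.
move=> SF; elim: r => [|i r IHr]; first by rewrite !big_nil linear_on_span0.
rewrite !big_cons ylin ?IHr //; apply: in_span_sum => j _.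
by rewrite -[_ *: _]addr0; apply: in_span_comb => //; exact: in_span0.
Qed.

End Cone.

Section Indicators.
Variables (S : {fset {mpoly R[n]}}) (y : {mpoly R[n]} -> R).
Variables (m : nat) (A : 'M[R]_(m, n)).
Hypothesis sol : relaxed_solution S (cover_constraints A) y.
Variables (q : {mpoly R[n]}) (b : {set 'I_n} -> bool).
Hypotheses (qS : q \in S) (qb : forall K, cube_eval q K = (b K)%:R).

Let sqr_b K : (b K)%:R ^+ 2 = (b K)%:R :> R.
Proof. by case: (b K); rewrite ?expr1n ?expr0n. Qed.

Lemma interpolant_indicator :
  interpolant (fun K => (b K)%:R) = mlin (xvar R None * q * q).
Proof.
rewrite mlinE; apply: eq_interpolant => K.
by rewrite !cube_evalM cube_eval1 mul1r qb -expr2 sqr_b.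
Qed.

Lemma interpolant_indicator_var j :
  interpolant (fun K => (b K)%:R * (j \in K)%:R) = mlin (xvar R (Some j) * q * q).
Proof.
rewrite mlinE; apply: eq_interpolant => K.
by rewrite !cube_evalM cube_evalX -mulrA qb -expr2 sqr_b mulrC.
Qed.

Lemma certified_indicator : certified S y (fun K => (b K)%:R).
Proof.
case: sol => _ ysq _; rewrite /certified interpolant_indicator.
split; first exact/in_span_mem/mem_products.
by rewrite mul1r -expr2 ysq.
Qed.

Lemma certified_indicator_var j :
  certified S y (fun K => (b K)%:R * (j \in K)%:R).
Proof.
case: sol => _ _ yc; rewrite /certified interpolant_indicator_var.
split; first exact/in_span_mem/mem_products.
by have := yc q (inr j) qS; rewrite /= -mulrA -expr2 mulrC.
Qed.

Lemma certified_indicator_row i :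
  certified S y (fun K => (b K)%:R * (\sum_j A i j * (j \in K)%:R - 1)).
Proof.
case: sol => ylin _ yc; split; last first.
  have := yc q (inl i) qS; congr (0 <= y _); rewrite mlinE.
  apply: eq_interpolant => K; rewrite cube_evalM cube_evalX2 qb sqr_b.
  rewrite /= cube_evalB cube_eval1 cube_eval_sum; congr (_ * (_ - _)).
  by apply: eq_bigr => j _; rewrite cube_evalZ cube_evalX.
rewrite (@eq_interpolant _ _ _ (fun K => (-1) * (b K)%:R +
    \sum_j A i j * ((b K)%:R * (j \in K)%:R))); last first.
  move=> K; rewrite mulrBr mulr1 mulN1r addrC mulr_sumr; congr (_ + _).
  by apply: eq_bigr => j _; ring.
rewrite interpolant_comb; apply: in_span_comb.
  by rewrite interpolant_indicator; exact/in_span_mem/mem_products.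
rewrite /interpolant; under eq_bigr do rewrite scaler_suml.
rewrite exchange_big; apply: in_span_sum => j _.
under eq_bigr do rewrite -scalerA.
rewrite -scaler_sumr -[_ *: _]addr0; apply: in_span_comb (in_span0 _).
rewrite -/(interpolant (fun K => (b K)%:R * (j \in K)%:R)).
by rewrite interpolant_indicator_var; exact/in_span_mem/mem_products.
Qed.

End Indicators.

End Certified.

(** * Rows, restrictions and critical rows *)

Section Rows.
Variables (R : realType) (n : nat).
Implicit Types (I J K V H F : {set 'I_n}).

(** Feasibility of the 0/1 point with support [K]. *)
Definition cover m (A : 'M[R]_(m, n)) K : Prop :=
  forall i, ~~ [disjoint supp A i & K].

Lemma zero_oneE m (A : 'M[R]_(m, n)) i j :
  zero_one A -> A i j = (j \in supp A i)%:R.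
Proof.
by rewrite inE => /(_ i j)[->|->]; rewrite ?eqxx ?oner_eq0.
Qed.

Lemma row_sum m (A : 'M[R]_(m, n)) i K : zero_one A ->
  \sum_j A i j * (j \in K)%:R = #|supp A i :&: K|%:R.
Proof.
move=> A01; rewrite -sum1_card natr_sum [RHS]big_mkcond; apply: eq_bigr => j _.
rewrite (zero_oneE _ _ A01) in_setI.
by case: (j \in supp A i); case: (j \in K); rewrite ?mulr1 ?mulr0.
Qed.

Lemma valid_cover m (A : 'M[R]_(m, n)) (a : 'cV[R]_n) (a0 : R) K :
  zero_one A -> valid A a a0 -> cover A K -> a0 <= \sum_(j in K) a j 0.
Proof.
move=> A01 vA cK; have := vA (\col_j (j \in K)%:R).
have -> : \sum_i a i 0 * (\col_j (j \in K)%:R) i 0 = \sum_(j in K) a j 0.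
  rewrite [RHS]big_mkcond; apply: eq_bigr => j _; rewrite mxE.
  by case: (j \in K); rewrite ?mulr1 ?mulr0.
rewrite subr_ge0; apply; split=> i; first by rewrite mxE; case: (i \in K); rewrite ?expr1n ?expr0n subrr.
rewrite mxE; under eq_bigr do rewrite mxE.
rewrite row_sum // ler1n card_gt0; apply: contra (cK i).
by rewrite setI_eq0.
Qed.

Lemma undominated_sub m (A : 'M[R]_(m, n)) i :
  exists2 k, k \in undominated A & supp A k \subset supp A i.
Proof.
(* [M] orders the rows by size of the support, then by index. *)
pose M k := (#|supp A k| * m + k)%N.
case: (@arg_minnP _ i (fun k => supp A k \subset supp A i) M) => // k ki kmin.
exists k => //; rewrite inE; apply/forallP=> l; apply/implyP=> /andP[lk sub].
have := kmin l (subset_trans sub ki); rewrite /M.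
have := subset_leq_card sub; rewrite leq_eqVlt => /orP[/eqP ee|lt].
  rewrite ee leq_add2l leq_eqVlt eq_sym => /orP[/eqP/val_inj e|->].
    by rewrite e eqxx in lk.
  by rewrite andbT eqEcard sub ee leqnn.
rewrite leqNgt => /negP[]; apply: leq_trans (leq_addr _ _).
apply: (@leq_trans (#|supp A l|.+1 * m)); last by rewrite leq_mul2r lt orbT.
by rewrite mulSn addnC ltn_add2r.
Qed.

Lemma restrictE m (A : 'M[R]_(m, n)) J F i :
  exists2 k, [disjoint supp A k & J] &
    forall j, restrict A J F i j = if j \in F then 0 else A k j.
Proof.
rewrite /restrict /remove_dominated; set P := [set _ | _].
pose k := enum_val (enum_val i); exists k; last by move=> j; rewrite !mxE.
by have := enum_valP (enum_val i); rewrite inE.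
Qed.

Lemma restrict_zero_one m (A : 'M[R]_(m, n)) J F :
  zero_one A -> zero_one (restrict A J F).
Proof.
move=> A01 i j; have [k _ ->] := restrictE i.
by case: ifP => _; [left | exact: A01].
Qed.

(** A row that meets [J] is covered by [J]; any other row contains, off
    [V :\: J], the support of an undominated row of the restriction. *)
Lemma cover_restrict m (A : 'M[R]_(m, n)) V J K :
  J \subset V -> cover (restrict A J (V :\: J)) K ->
  cover A (J :|: (K :\: V)).
Proof.
move=> JV cK i; rewrite /cover in cK.
case: (boolP [disjoint supp A i & J]) => [dJ|]; last first.
  apply: contra => /disjointWr; apply; exact: subsetUl.
move: cK; rewrite /restrict /remove_dominated.
set P := [set _ | _]; set B := zero_cols _ _ => cK.
have iP : i \in P by rewrite inE.
have [k ku ks] := undominated_sub B (enum_rank_in iP i).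
have := cK (enum_rank_in ku k).
have -> : supp (keep_rows B (undominated B)) (enum_rank_in ku k) = supp B k.
  by apply/setP=> j; rewrite !inE mxE enum_rankK_in.
case/pred0Pn => j /andP[/= /(subsetP ks)].
rewrite !inE !mxE enum_rankK_in // inE.
case: ifP; rewrite ?eqxx // => jVJ Aij jK.
apply/pred0Pn; exists j; rewrite /= !inE Aij jK /=.
by case: (j \in J) jVJ => //= ->.
Qed.

Lemma sum_disjoint (a : 'I_n -> R) (B D : {set 'I_n}) : [disjoint B & D] ->
  \sum_(j in B :|: D) a j = \sum_(j in B) a j + \sum_(j in D) a j.
Proof. by move=> BD; rewrite -bigU //; apply: eq_bigl => j; rewrite !inE. Qed.

Lemma exists_argmin (a : 'I_n -> R) (B : {set 'I_n}) : B != set0 ->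
  exists2 j, j \in B & forall l, l \in B -> a j <= a l.
Proof.
by case/set0Pn=> j0 j0B; case: (arg_minP a j0B) => j jB jmin; exists j.
Qed.

(** Attach to each row the position of its smallest weight, and take [C] maximal
    among the sets of at most [pi] rows inside the support of [a] whose attached
    positions are distinct; [w] is the smallest weight of the row. If [C] has
    [pi] rows, the pitch condition bounds the weight of the positions. If it has
    fewer, the positions together with the complement of the support of [a]
    form a cover, since a row missed by them could be added to [C]; validity
    then gives the bound. *)
Lemma exists_critical_rows m (A : 'M[R]_(m, n)) (a : 'I_n -> R) (a0 : R) pi :
  (forall i, supp A i != set0) -> (forall j, 0 <= a j) ->
  (forall K, cover A K -> a0 <= \sum_(j in K) a j) ->
  (forall J, J \subset [set j | 0 < a j] -> (pi <= #|J|)%N ->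
     a0 <= \sum_(j in J) a j) ->
  exists (C : {set 'I_m}) (w : 'I_m -> R),
    [/\ (#|C| <= pi)%N,
        forall i, 0 <= w i,
        forall i j, j \in supp A i -> w i <= a j,
        forall i, i \in C -> supp A i \subset [set j | 0 < a j] &
        a0 <= \sum_(i in C) w i].
Proof.
move=> A0 a_ge0 acover apitch; set P := [set j | _].
have [f fA fmin] := fin_all_exists2 (fun i => exists_argmin a (A0 i)).
pose crit (C : {set 'I_m}) := [&& (#|C| <= pi)%N,
  [forall i in C, supp A i \subset P] & #|f @: C| == #|C|].
have [|C /maxsetP[/and3P[Cpi CP Cinj] Cmax]] := @ex_maxset _ crit.
  exists set0; rewrite /crit cards0 imset0 cards0 /= andbT.
  by apply/forall_inP => i; rewrite inE.
have {}CP := forall_inP CP.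
exists C, (a \o f); split=> //=.
have -> : \sum_(i in C) a (f i) = \sum_(j in f @: C) a j.
  by rewrite big_imset //=; apply/imset_injP.
have fP : f @: C \subset P.
  by apply/subsetP=> _ /imsetP[i iC ->]; apply: (subsetP (CP i iC)).
case: (leqP pi #|C|) => [piC|Cpi'].
  by apply: apitch => //; rewrite (eqP Cinj).
apply: le_trans (_ : _ <= \sum_(j in f @: C :|: ~: P) a j) _.
  apply: acover => i; apply/negP => dis.
  have iP : supp A i \subset P.
    rewrite -[P]setCK -disjoints_subset; apply: disjointWr dis; exact: subsetUr.
  have fiC : f i \notin f @: C.
    apply/negP => fiC; case/pred0Pn: dis; exists (f i) => /=.
    by rewrite fA inE fiC.
  have iC : i \notin C by apply: contra fiC; apply: imset_f.
  have := Cmax (i |: C); rewrite subsetUr => e.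
  have : i \in C; last by apply/negP.
  rewrite -e ?setU11 //; apply/and3P; split.
  - by rewrite cardsU1 iC.
  - by apply/forall_inP => k; rewrite !inE => /orP[/eqP->|/CP].
  - by rewrite imsetU1 !cardsU1 fiC iC (eqP Cinj).
rewrite (big_setID P) /= [X in _ + X]big1 => [|j].
  by rewrite addr0 setIUl [~: P :&: P]setIC setICr setU0 (setIidPl fP).
rewrite !inE => /andP[/negPf jP _].
by apply/eqP; rewrite eq_le a_ge0 andbT leNgt jP.
Qed.

(** The threshold [b] spares the argument on slices an explicit ordering of the
    weights. *)
Lemma exists_smallest (a : 'I_n -> R) V p : (forall j, 0 <= a j) -> (p <= #|V|)%N ->
  exists (H : {set 'I_n}) (b : R),
    [/\ H \subset V, #|H| = p, 0 <= b, forall j, j \in H -> a j <= b &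
        forall j, j \in V :\: H -> b <= a j].
Proof.
move=> a0; elim: p => [_|p IHp pV].
  exists set0, 0; rewrite sub0set cards0; split=> // j; rewrite inE //.
have [H [b [HV Hp b0 Hb VHb]]] := IHp (ltnW pV).
have [|x xVH xmin] := @exists_argmin a (V :\: H).
  rewrite setD_eq0; apply: contraL pV => /subset_leq_card.
  by rewrite Hp -ltnNge.
exists (x |: H), (a x); move: (xVH); rewrite inE => /andP[xH xV]; split=> //.
- by rewrite subUset sub1set xV.
- by rewrite cardsU1 xH Hp.
- move=> j; rewrite !inE => /orP[/eqP-> //|/Hb]; move/le_trans; apply.
  exact: VHb.
- move=> j; rewrite !inE negb_or -andbA => /and3P[_ jH jV].
  by apply: xmin; rewrite inE jH.
Qed.

End Rows.

Section Members.
Variables (R : realType) (n : nat).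
Variables (m pi : nat) (A : 'M[R]_(m, n)) (C : {set 'I_m}).
Hypothesis Cpi : (#|C| <= pi.+1)%N.
Let V := overlap A C.

Lemma mem_SA_delta0 : delta R V set0 \in SA pi.+1 A.
Proof.
apply/bigfcupP; exists C; first by rewrite mem_index_enum inE.
by rewrite !inE eqxx.
Qed.

Lemma mem_SA_delta (J : {set 'I_n}) q : J \subset V -> (0 < #|J| < pi.+1)%N ->
  q \in SA (pi - #|J|.-1) (restrict A J (V :\: J)) ->
  delta R V J * q \in SA pi.+1 A.
Proof.
move=> JV Jpi qS; apply/bigfcupP; exists C; first by rewrite mem_index_enum inE.
rewrite !in_fsetU; apply/orP; left; apply/orP; right.
apply/bigfcupP; exists J; first by rewrite mem_index_enum powersetE JV.
by apply/imfsetP; exists q.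
Qed.

Lemma mem_SA_sym (H I : {set 'I_n}) k : H \subset V -> (#|H| <= pi.+1)%N -> I \subset H ->
  (pi.+1 - #|I| <= k <= #|V|)%N ->
  sym_delta R V H I k \in SA pi.+1 A.
Proof.
move=> HV Hpi IH /andP[kge kle].
apply/bigfcupP; exists C; first by rewrite mem_index_enum inE.
rewrite !in_fsetU; apply/orP; right.
apply/bigfcupP; exists H; first by rewrite mem_index_enum powersetE HV.
apply/bigfcupP; exists I; first by rewrite mem_index_enum powersetE IH.
by apply/imfsetP; exists (inord k); rewrite /= ?inE inordK.
Qed.

End Members.

Lemma mem_SA1 (R : realType) (n m pi : nat) (A : 'M[R]_(m, n)) : 1 \in SA pi A.
Proof.
case: pi => [|pi]; first by rewrite inE.
have := @mem_SA_delta0 R n m pi A set0; rewrite cards0 => /(_ isT).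
have -> : overlap A set0 = set0.
  by apply/setP=> v; rewrite !inE; apply/existsP => -[i]; rewrite inE.
by rewrite /delta set0D !big_set0 mulr1.
Qed.

(** * Conditioning *)

Section Conditioning.
Variables (R : realType) (n : nat).
Implicit Types (p q : {mpoly R[n]}) (y : {mpoly R[n]} -> R).

Lemma mlin_comb (c : R) p q : mlin (c *: p + q) = c *: mlin p + mlin q.
Proof.
rewrite !mlinE -interpolant_comb; apply: eq_interpolant => K.
by rewrite /cube_eval mevalD mevalZ.
Qed.

Lemma mlin_sum (I : Type) (r : seq I) (F : I -> {mpoly R[n]}) (a : I -> R) :
  mlin (\sum_(i <- r) a i *: F i) = \sum_(i <- r) a i *: mlin (F i).
Proof.
elim: r => [|i r IHr].
  rewrite !big_nil mlinE /interpolant big1 // => K _.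
  by rewrite /cube_eval meval0 scale0r.
by rewrite !big_cons mlin_comb IHr.
Qed.

Variables (S S' : {fset {mpoly R[n]}}) (V J : {set 'I_n}).
Hypotheses (JV : J \subset V) (SS' : forall q, q \in S' -> delta R V J * q \in S).

Let idem (d : {mpoly R[n]}) := forall K, cube_eval d K ^+ 2 = cube_eval d K.

Lemma delta_idem : idem (delta R V J).
Proof.
by move=> K; rewrite cube_eval_delta //; case: (_ == _); rewrite ?expr1n ?expr0n.
Qed.

(** On the cube [delta * (x_i q r)] equals [x_i (delta q) (delta r)], because
    [delta] is idempotent there. *)
Lemma in_span_conditional p : in_span (products S') p ->
  in_span (products S) (mlin (delta R V J * p)).
Proof.
move=> [c ->]; rewrite mulr_sumr.
under eq_bigr do rewrite -scalerAr.
rewrite mlin_sum big_seq; apply: in_span_sum => t /productsP[i [q [r [qS rS ->]]]].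
rewrite -[_ *: _]addr0; apply: in_span_comb (in_span0 _).
rewrite (@eq_mlin _ _ _ (xvar R i * (delta R V J * q) * (delta R V J * r))).
  by apply/in_span_mem/mem_products; apply: SS'.
move=> K; move: (delta_idem K); move: (delta R V J) => d dd.
rewrite !cube_evalM cube_eval_mlin !cube_evalM.
by rewrite -[X in X * _ = _]dd; ring.
Qed.

Lemma certified_conditional y (f : {set 'I_n} -> R) :
  certified S' (fun p => y (mlin (delta R V J * p))) f ->
  certified S y (fun K => (K :&: V == J)%:R * f K).
Proof.
case=> /in_span_conditional Sf f0; rewrite /certified.
have -> : interpolant (fun K => (K :&: V == J)%:R * f K) =
          mlin (delta R V J * interpolant f).
  rewrite mlinE; apply: eq_interpolant => K.
  by rewrite cube_evalM cube_eval_delta // cube_eval_interpolant.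
by [].
Qed.

(** Only the values of the constraints on the event [L :&: V = J] matter: [delta]
    vanishes elsewhere. *)
Lemma relaxed_conditional (K K' : Type) (g : K -> {mpoly R[n]})
    (g' : K' -> {mpoly R[n]}) y :
  (forall k', exists k, forall L, L :&: V = J ->
     cube_eval (g' k') L = cube_eval (g k) L) ->
  relaxed_solution S g y ->
  relaxed_solution S' g' (fun p => y (mlin (delta R V J * p))).
Proof.
move=> gg' [ylin ysq yc].
split=> [c p q pS qS | q qS | q k' qS].
- rewrite mulrDr -scalerAr mlin_comb ylin //; exact: in_span_conditional.
- have := ysq _ (SS' qS); congr (0 <= y _); apply: eq_mlin => L.
  move: (delta_idem L); move: (delta R V J) => d dd.
  by rewrite cube_evalX2 !cube_evalM cube_eval_mlin cube_evalX2 exprMn dd.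
- have [k gk] := gg' k'.
  have := yc _ k (SS' qS); congr (0 <= y _); apply: eq_mlin => L.
  move: (delta_idem L) (cube_eval_delta R L JV); move: (delta R V J) => d dd dE.
  rewrite !cube_evalM cube_eval_mlin !cube_evalM.
  transitivity (cube_eval d L ^+ 2 * (cube_eval q L ^+ 2 * cube_eval (g k) L)).
    by ring.
  rewrite dd dE expr2.
  by case: eqP => [/gk->|_]; rewrite ?mul1r ?mul0r.
Qed.

End Conditioning.

(** * The three parts of the decomposition *)

Section Decomposition.
Variables (R : realType) (n m pi : nat) (A : 'M[R]_(m, n)).
Variables (a : 'I_n -> R) (a0 : R) (y : {mpoly R[n]} -> R).
Hypothesis sol : relaxed_solution (SA pi.+1 A) (cover_constraints A) y.
Hypothesis a_ge0 : forall j, 0 <= a j.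

Let ylin : linear_on_span (products (SA pi.+1 A)) y.
Proof. by case: sol. Qed.

Variable C : {set 'I_m}.
Hypothesis Cpi : (#|C| <= pi.+1)%N.
Let V := overlap A C.

Lemma big_setD_weight (K : {set 'I_n}) :
  \sum_(j in K) a j = \sum_(j in K :&: V) a j + \sum_(j | j \notin V) a j * (j \in K)%:R.
Proof.
rewrite (big_setID V) /=; congr (_ + _).
rewrite [LHS]big_mkcond [RHS]big_mkcond; apply: eq_bigr => j _; rewrite in_setD.
by case: (j \in V); case: (j \in K); rewrite ?mulr1 ?mulr0.
Qed.

(** When [K] avoids [V], an index of [K] lies in at most one row of [C], so that
    the sum of the row constraints with weights [w] uses at most the coefficient
    [a j] at [j]; the excess [r j] is certified by the coordinate [j]. *)
Lemma certified_empty_trace (w : 'I_m -> R) :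
  zero_one A -> (forall i, 0 <= w i) ->
  (forall i j, j \in supp A i -> w i <= a j) -> a0 <= \sum_(i in C) w i ->
  certified (SA pi.+1 A) y
    (fun K => (K :&: V == set0)%:R * (\sum_(j in K) a j - a0)).
Proof.
move=> A01 w0 wa a0w.
have dS := mem_SA_delta0 A Cpi; rewrite -/V in dS.
have dE K : cube_eval (delta R V set0) K = (K :&: V == set0)%:R.
  by rewrite cube_eval_delta ?sub0set.
pose r j := a j - \sum_(i in C) w i * A i j.
have r0 j : j \notin V -> 0 <= r j.
  move=> jV; rewrite subr_ge0.
  case: (pickP (fun i => (i \in C) && (j \in supp A i))) => [i|none].
    move=> /andP[iC ji]; rewrite (bigD1 i) //= big1 => [|k /andP[kC ki]].
      by rewrite addr0 (zero_oneE _ _ A01) ji mulr1 wa.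
    rewrite (zero_oneE _ _ A01); case: (boolP (j \in supp A k)) => jk; last exact: mulr0.
    case/negP: jV; rewrite in_set; apply/exists_inP; exists k => //.
    by apply/exists_inP; exists i => //; rewrite ki in_setI jk ji.
  rewrite big1 // => i iC; have := none i; rewrite iC /= (zero_oneE _ _ A01) => ->.
  exact: mulr0.
apply: (@certified_ext _ _ _ _ (fun K =>
   (\sum_(i in C) w i * ((K :&: V == set0)%:R *
      (\sum_j A i j * (j \in K)%:R - 1)) +
    (\sum_(i in C) w i - a0) * (K :&: V == set0)%:R) +
    \sum_(j | j \notin V) r j * ((K :&: V == set0)%:R * (j \in K)%:R))).
  apply: certifiedD => //; first apply: certifiedD => //.
  - apply: certified_sum => // i iC; apply: certifiedZ => //.
    exact: certified_indicator_row sol _ _ dS dE i.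
  - apply: certifiedZ; rewrite ?subr_ge0 //; exact: certified_indicator sol _ _ dS dE.
  - apply: certified_sum => // j jV; apply: certifiedZ; rewrite ?r0 //.
    exact: certified_indicator_var sol _ _ dS dE j.
move=> K; case: eqP => [KV|_]; last first.
  rewrite !mul0r mulr0 !big1 ?addr0 // => i _; by rewrite mul0r mulr0.
rewrite big_setD_weight KV big_set0 add0r !mul1r mulr1.
under eq_bigr do rewrite mul1r mulrBr mulr1 mulr_sumr.
rewrite sumrB exchange_big /=.
have -> : \sum_j \sum_(i in C) w i * (A i j * (j \in K)%:R) =
          \sum_(j | j \notin V) (\sum_(i in C) w i * A i j) * (j \in K)%:R.
  rewrite [RHS]big_mkcond; apply: eq_bigr => j _; rewrite mulr_suml.
  case: ifP => [_|/negbFE jV]; first by apply: eq_bigr => i _; rewrite mulrA.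
  have jK : j \in K = false.
    by apply: contraTF jV => jK; apply/negP => jV; move/setP: KV => /(_ j); rewrite in_setI in_set0 jK jV.
  by rewrite big1 // => i _; rewrite jK !mulr0.
have -> : \sum_(j | j \notin V) r j * (1 * (j \in K)%:R) =
   \sum_(j | j \notin V) a j * (j \in K)%:R -
   \sum_(j | j \notin V) (\sum_(i in C) w i * A i j) * (j \in K)%:R.
  by rewrite -sumrB; apply: eq_bigr => j _; rewrite /r mul1r mulrBl.
by ring.
Qed.

(** Let [H] consist of the [pi.+1] smallest weights of [V], with [b] between them
    and the others. If [#|K :&: V| = k], then [a K] is the sum of
    [a (K :&: H) + b * (k - #|K :&: H|)], of the excesses [a j - b >= 0] over
    [K :&: V :\: H], and of the weights of [K] off [V]. With [a0] subtracted, the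
    first term is the coefficient [c (K :&: H)] of a symmetric sum; it is
    nonnegative because replacing [b] by the weights of [H] missing from [K]
    only decreases it, down to at least [a H - a0]. *)
Lemma certified_slice (k : nat) :
  (pi.+1 <= k <= #|V|)%N -> V \subset [set j | 0 < a j] ->
  (forall J : {set 'I_n}, J \subset [set j | 0 < a j] -> (pi.+1 <= #|J|)%N ->
     a0 <= \sum_(j in J) a j) ->
  certified (SA pi.+1 A) y
    (fun K => (#|K :&: V| == k)%:R * (\sum_(j in K) a j - a0)).
Proof.
move=> /andP[kpi kV] VP apitch.
have [H [b [HV Hpi b0 Hb bVH]]] := exists_smallest a_ge0 (leq_trans kpi kV).
pose c (I : {set 'I_n}) := \sum_(j in I) a j + b * (k - #|I|)%:R - a0.
have c0 (I : {set 'I_n}) : I \subset H -> 0 <= c I.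
  move=> IH; rewrite subr_ge0; apply: le_trans (apitch H _ _) _; rewrite ?Hpi //.
    exact: subset_trans HV VP.
  rewrite (big_setID I) /= (setIidPr IH) lerD2l.
  apply: (@le_trans _ _ (\sum_(j in H :\: I) b)).
    by apply: ler_sum => j; rewrite inE => /andP[_ /Hb].
  rewrite sumr_const -[b *+ _]mulr_natr ler_wpM2l // ler_nat cardsD (setIidPr IH) Hpi.
  exact: leq_sub2r.
apply: (@certified_ext _ _ _ _ (fun K =>
   (\sum_(I in powerset H) c I * ((K :&: H == I) && (#|K :&: V| == k))%:R +
    \sum_(j in V :\: H) (a j - b) *
        ((K :&: [set j] == [set j]) && (#|K :&: V| == k))%:R) +
    \sum_(j | j \notin V) a j * (((K :&: set0 == set0) && (#|K :&: V| == k))%:R *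
        (j \in K)%:R))).
  apply: certifiedD => //; first apply: certifiedD => //.
  - apply: certified_sum => // I; rewrite powersetE => IH.
    have Ik : (#|I| <= k)%N.
      by apply: leq_trans kpi; rewrite -Hpi subset_leq_card.
    apply: certifiedZ; rewrite ?c0 //.
    apply: (certified_indicator sol (q := sym_delta R V H I (k - #|I|))).
      apply: mem_SA_sym; rewrite ?Hpi // leq_sub2r //=.
      by apply: leq_trans kV; exact: leq_subr.
    move=> K; rewrite cube_eval_sym_delta // addnC subnK //.
  - apply: certified_sum => // j jVH; apply: certifiedZ; rewrite ?subr_ge0 ?bVH //.
    have jV : [set j] \subset V by rewrite sub1set; case/setDP: jVH.
    apply: (certified_indicator sol (q := sym_delta R V [set j] [set j] k.-1)).
      apply: mem_SA_sym; rewrite ?cards1 //.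
      by rewrite subn1 -!subn1 leq_sub2r //=; apply: leq_trans kV; exact: leq_subr.
    by move=> K; rewrite cube_eval_sym_delta // cards1 add1n prednK // (leq_trans _ kpi).
  - apply: certified_sum => // j jV; apply: certifiedZ; rewrite ?a_ge0 //.
    apply: (certified_indicator_var sol (q := sym_delta R V set0 set0 k)).
      by apply: mem_SA_sym; rewrite ?sub0set ?cards0 // subn0 kpi.
    by move=> K; rewrite cube_eval_sym_delta ?sub0set // cards0 add0n.
move=> K; case: eqP => [Kk|_]; last first.
  rewrite mul0r !big1 ?addr0 // => i _; rewrite ?andbF ?mul0r ?mulr0 //.
under eq_bigr do rewrite andbT.
rewrite (bigD1 (K :&: H)) /=; last by rewrite powersetE subsetIr.
rewrite eqxx mulr1 big1 => [|I /andP[_ /negPf IN]]; last by rewrite eq_sym IN mulr0.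
rewrite addr0 mul1r big_setD_weight.
have -> : \sum_(j | j \notin V) a j * (((K :&: set0 == set0) && true)%:R * (j \in K)%:R)
   = \sum_(j | j \notin V) a j * (j \in K)%:R.
  by apply: eq_bigr => j _; rewrite setI0 eqxx mul1r.
have -> : \sum_(j in V :\: H) (a j - b) * ((K :&: [set j] == [set j]) && true)%:R
   = \sum_(j in K :&: V :\: H) (a j - b).
  rewrite [LHS]big_mkcond [RHS]big_mkcond; apply: eq_bigr => j _.
  rewrite !in_setD in_setI andbT (sameP eqP setIidPr) sub1set.
  by case: (j \in H); case: (j \in V); case: (j \in K); rewrite ?mulr1 ?mulr0.
rewrite [\sum_(j in K :&: V) _](big_setID H) /= sumrB sumr_const.
have -> : K :&: V :&: H = K :&: H by rewrite -setIA (setIidPr HV).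
by rewrite cardsD Kk -setIA (setIidPr HV) /c -[b *+ _]mulr_natr; ring.
Qed.

(** The rows of the restricted matrix agree with rows of [A] on the event
    [K :&: V = J], where the columns of [V :\: J] contribute nothing; a
    certificate for the restricted problem is thus one conditional on this
    event. *)
Lemma certified_trace (J : {set 'I_n}) :
  J \subset V -> (0 < #|J| < pi.+1)%N ->
  (forall y', relaxed_solution (SA (pi - #|J|.-1) (restrict A J (V :\: J)))
     (cover_constraints (restrict A J (V :\: J))) y' ->
   certified (SA (pi - #|J|.-1) (restrict A J (V :\: J))) y'
     (fun K => \sum_(j in K) (if j \in V then 0 else a j) - (a0 - \sum_(j in J) a j))) ->
  certified (SA pi.+1 A) y
    (fun K => (K :&: V == J)%:R * (\sum_(j in K) a j - a0)).
Proof.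
move=> JV Jpi IH.
have SS' q : q \in SA (pi - #|J|.-1) (restrict A J (V :\: J)) ->
    delta R V J * q \in SA pi.+1 A by exact: mem_SA_delta.
apply: certified_ext (certified_conditional JV SS' (IH _ _)) _; last first.
  move=> K /=; case: eqP => [KV|_]; last by rewrite !mul0r.
  rewrite (big_setD_weight K) KV !mul1r.
  have -> : \sum_(j in K) (if j \in V then 0 else a j) =
      \sum_(j | j \notin V) a j * (j \in K)%:R.
    rewrite [LHS]big_mkcond [RHS]big_mkcond; apply: eq_bigr => j _.
    by case: (j \in V); case: (j \in K); rewrite ?mulr1 ?mulr0.
  by ring.
apply: (relaxed_conditional JV SS' _ sol) => -[i|j]; last by exists (inr j).
have [k _ rk] := restrictE i; exists (inl k) => L LV.
rewrite !cube_evalB !cube_eval_sum; congr (_ - _); apply: eq_bigr => j _.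
rewrite !cube_evalZ cube_evalX rk; case: ifP => // jVJ.
have -> : (j \in L) = false; last by rewrite !mulr0.
by move: jVJ; rewrite -LV in_setD in_setI; case: (j \in L); case: (j \in V).
Qed.

End Decomposition.

(** * Every bounded-pitch inequality is certified *)

Theorem certified_pitch (R : realType) (n pi m : nat) (A : 'M[R]_(m, n))
    (a : 'I_n -> R) (a0 : R) (y : {mpoly R[n]} -> R) :
  zero_one A -> (forall j, 0 <= a j) ->
  (forall K, cover A K -> a0 <= \sum_(j in K) a j) ->
  (forall J : {set 'I_n}, J \subset [set j | 0 < a j] -> (pi <= #|J|)%N ->
     a0 <= \sum_(j in J) a j) ->
  relaxed_solution (SA pi A) (cover_constraints A) y ->
  certified (SA pi A) y (fun K => \sum_(j in K) a j - a0).
Proof.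
elim/ltn_ind: pi m A a a0 y => pi IH m A a a0 y A01 a_ge0 acover apitch sol.
have ylin : linear_on_span (products (SA pi A)) y by case: sol.
pose yes := fun _ : {set 'I_n} => true.
have oneE K : cube_eval 1 K = (yes K)%:R :> R by rewrite cube_eval1.
have one_cert := certified_indicator sol (mem_SA1 pi A) oneE.
have weight_cert : certified (SA pi A) y (fun K => \sum_(j in K) a j).
  apply: (@certified_ext _ _ _ _ (fun K => \sum_j a j * (true%:R * (j \in K)%:R))).
    apply: certified_sum => // j _; apply: certifiedZ; rewrite ?a_ge0 //.
    exact: (certified_indicator_var sol (mem_SA1 pi A) oneE).
  move=> K; rewrite [RHS]big_mkcond; apply: eq_bigr => j _; rewrite mul1r.
  by case: (j \in K); rewrite ?mulr1 ?mulr0.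
case: (leP a0 0) => a00.
  apply: (@certified_ext _ _ _ _ (fun K => - a0 * true%:R + \sum_(j in K) a j)).
    by apply: certified_comb => //; rewrite oppr_ge0.
  by move=> K; rewrite mulr1 addrC.
case: pi => [|pi] in IH apitch sol ylin one_cert weight_cert *.
  have := apitch set0; rewrite sub0set cards0 big_set0 => /(_ isT isT).
  by rewrite leNgt a00.
(* An empty row makes the problem infeasible: its constraint reads [-1 >= 0]. *)
case: (pickP (fun i => supp A i == set0)) => [i /eqP i0|A0].
  apply: (@certified_ext _ _ _ _ (fun K =>
      a0 * (true%:R * (\sum_j A i j * (j \in K)%:R - 1)) + \sum_(j in K) a j)).
    apply: certified_comb => //; first exact: ltW.
    exact: (certified_indicator_row sol (mem_SA1 pi.+1 A) oneE).
  by move=> K; rewrite row_sum // i0 set0I cards0 mul1r; ring.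
have [C [w [Cpi w0 wa CP a0w]]] :=
  exists_critical_rows (fun i => negbT (A0 i)) a_ge0 acover apitch.
pose V := overlap A C.
have VP : V \subset [set j | 0 < a j].
  apply/subsetP=> j; rewrite [j \in V]in_set => /exists_inP[i iC].
  case/exists_inP=> k _ /andP[_]; rewrite in_setI => /andP[+ _].
  exact/subsetP/CP.
(* Traces on [V] with fewer than [pi.+1] elements are treated one by one, the
   others together with all those of the same size. *)
apply: (@certified_ext _ _ _ _ (fun K =>
   \sum_(J in powerset V | (#|J| < pi.+1)%N)
      (K :&: V == J)%:R * (\sum_(j in K) a j - a0) +
   \sum_(k : 'I_#|V|.+1 | (pi.+1 <= k)%N)
      (#|K :&: V| == k)%:R * (\sum_(j in K) a j - a0))); last first.
  move=> K; rewrite -!mulr_suml -mulrDl.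
  have KV : K :&: V \in powerset V by rewrite powersetE subsetIr.
  have KVlt : (#|K :&: V| < #|V|.+1)%N by rewrite ltnS subset_leq_card ?subsetIr.
  case: (ltnP #|K :&: V| pi.+1) => Kpi.
    rewrite (bigD1 (K :&: V)) ?KV //= eqxx big1 => [|J /andP[_ /negPf JN]]; last first.
      by rewrite eq_sym JN.
    rewrite big1 => [|k kpi]; first by rewrite !addr0 mul1r.
    by case: eqP => // e; rewrite leqNgt -e Kpi in kpi.
  rewrite big1 => [|J /andP[_ Jpi]]; last first.
    by case: eqP => // e; rewrite ltnNge -e Kpi in Jpi.
  rewrite (bigD1 (Ordinal KVlt)) //= eqxx big1 ?addr0 ?add0r ?mul1r //.
  move=> k /andP[_ kN]; case: eqP => // e; case/eqP: kN; exact/val_inj.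
apply: certifiedD => //.
  apply: certified_sum => // J; rewrite powersetE => /andP[JV Jpi].
  case: (posnP #|J|) => [/eqP|J0]; first rewrite cards_eq0 => /eqP ->.
    exact: (certified_empty_trace sol a_ge0 Cpi A01 w0 wa a0w).
  apply: (certified_trace sol Cpi) => //; first by rewrite J0 Jpi.
  move=> y' sol'; apply: IH sol' => //.
  - lia.
  - exact: restrict_zero_one.
  - by move=> j; case: ifP.
  - move=> K /(cover_restrict JV)/acover; rewrite lerBlDl => /le_trans; apply.
    rewrite sum_disjoint; last first.
      rewrite disjoint_sym disjoints_subset setDE; apply: subset_trans (subsetIr _ _) _.
      by rewrite setCS.
    rewrite lerD2l [X in X <= _]big_mkcond [X in _ <= X]big_mkcond ler_sum // => j _.
    by rewrite in_setD; case: (j \in V); case: (j \in K).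
  - move=> J' J'P J'pi.
    have J'V : [disjoint J & J'].
      rewrite disjoint_sym; apply/pred0P => j /=; apply/negP => /andP[].
      by move/(subsetP J'P); rewrite inE; case: ifP; rewrite ?ltxx // => + _ /(subsetP JV) => ->.
    rewrite lerBlDl; apply: le_trans (apitch (J :|: J') _ _) _.
    + rewrite subUset (subset_trans JV VP); apply/subsetP=> j /(subsetP J'P).
      by rewrite !inE; case: ifP; rewrite ?ltxx.
    + rewrite cardsU; move: J'V; rewrite -setI_eq0 => /eqP->; rewrite cards0; lia.
    + rewrite sum_disjoint // lerD2l ler_sum // => j /(subsetP J'P).
      by rewrite inE; case: ifP; rewrite ?ltxx.
apply: certified_sum => // k kpi.
by apply: (certified_slice sol a_ge0 Cpi) => //; rewrite kpi -ltnS ltn_ord.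
Qed.

(** * The pitch condition *)

(** Removing the head of both sequences preserves the subsequence relation, and
    the head of a sorted sequence is below that of any subsequence. *)
Lemma sum_smallest_le_subseq (R : realType) (s t : seq R) p :
  sorted <=%R s -> {in s, forall x, 0 <= x} -> subseq t s -> (p <= size t)%N ->
  \sum_(0 <= i < p) s`_i <= \sum_(x <- t) x.
Proof.
elim: s t p => [|x s IHs] t p sorts s0 ts pt.
  move: ts pt; rewrite subseq0 => /eqP->; rewrite leqn0 => /eqP->.
  by rewrite big_geq // big_nil.
case: p t ts pt => [|p] [|z t] ts // pt.
- by rewrite big_geq // big_nil.
- by rewrite big_geq // big_seq sumr_ge0 // => w /(mem_subseq ts); exact: s0.
have zxs : z \in x :: s by apply: (mem_subseq ts); rewrite mem_head.
have ts' : subseq t s.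
  move: ts => /=; case: eqP => // _; exact/subseq_trans/subseq_cons.
rewrite big_nat_recl // big_cons lerD //=.
  move: zxs; rewrite inE => /orP[/eqP-> //|].
  by move/(allP (order_path_min le_trans sorts)).
apply: IHs => //; first exact: path_sorted sorts.
by move=> w ws; apply: s0; rewrite inE ws orbT.
Qed.

Lemma pitch_le_sum (R : realType) (n : nat) (a : 'cV[R]_n) a0 p
    (J : {set 'I_n}) :
  is_pitch a a0 p -> J \subset [set j | 0 < a j 0] -> (p <= #|J|)%N ->
  a0 <= \sum_(j in J) a j 0.
Proof.
move=> [+ _] JP pJ; rewrite subr_ge0 => /le_trans; apply.
pose t := [seq a i 0 | i <- enum 'I_n & i \in J].
have -> : \sum_(j in J) a j 0 = \sum_(x <- sort <=%R t) x.
  by rewrite (perm_big _ (permEl (perm_sort _ _))) /= big_map big_filter big_enum_cond.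
apply: sum_smallest_le_subseq.
- exact: sort_sorted le_total _.
- move=> x; rewrite mem_sort => /mapP[i]; rewrite mem_filter => /andP[ai _] ->.
  exact: ltW.
- apply: subseq_sort; [exact: le_total | exact: le_trans | apply: map_subseq].
  rewrite (_ : [seq i <- enum 'I_n | i \in J] =
    [seq i <- [seq i <- enum 'I_n | 0 < a i 0] | i \in J]) ?filter_subseq //.
  rewrite -[RHS]filter_predI; apply: eq_filter => i /=.
  by case: (boolP (i \in J)) => // /(subsetP JP); rewrite inE.
- rewrite size_sort size_map -sum1_size big_filter big_enum_cond.
  by rewrite sum1_card.
Qed.

(** * The number of polynomials *)

Section Size.
Local Open Scope nat_scope.

(** A set of at most [k] elements is listed by a word of length [k] over
    [option T], padded with [None]. *)
Lemma card_small_sets (T : finType) k :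
  #|[set B : {set T} | #|B| <= k]| <= #|T|.+1 ^ k.
Proof.
apply: (@leq_trans #|{ffun 'I_k -> option T}|); last first.
  by rewrite card_ffun card_option card_ord.
pose im (f : {ffun 'I_k -> option T}) := [set x | Some x \in codom f].
apply: leq_trans (leq_imset_card im _); apply: subset_leq_card.
apply/subsetP=> B; rewrite inE => Bk; apply/imsetP.
exists [ffun i : 'I_k => nth None (map Some (enum B)) i] => //.
apply/setP=> x; rewrite inE; apply/idP/codomP => [xB|[i]].
  have lt : index x (enum B) < #|B| by rewrite cardE index_mem mem_enum.
  exists (Ordinal (leq_trans lt Bk)); rewrite ffunE /= (nth_map x) -?cardE //.
  by rewrite nth_index ?mem_enum.
rewrite ffunE; case: (ltnP i (size (enum B))) => iB.
  by rewrite (nth_map x) // => -[->]; rewrite -mem_enum mem_nth.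
by rewrite nth_default ?size_map.
Qed.

Lemma card_fsetU_le (K : choiceType) (X Z : {fset K}) k l :
  #|` X| <= k -> #|` Z| <= l -> #|` X `|` Z|%fset <= k + l.
Proof.
move=> Xk Zl; rewrite cardfsU; apply: leq_trans (leq_subr _ _) _.
exact: leq_add.
Qed.

Lemma card_bigfcup_le (K : choiceType) (I : finType) (P : pred I)
    (F : I -> {fset K}) b N :
  #|P| <= N -> (forall i, P i -> #|` F i| <= b) ->
  #|` \bigcup_(i | P i) F i|%fset <= N * b.
Proof.
move=> PN Fb; apply: (@leq_trans (\sum_(i | P i) #|` F i|)).
  apply: (big_ind2 (fun (X : {fset K}) k => #|` X| <= k)) => //.
  by move=> X k Z l; exact: card_fsetU_le.
apply: (@leq_trans (\sum_(i | P i) b)); first exact: leq_sum.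
by rewrite sum_nat_const leq_mul2r PN orbT.
Qed.

Lemma card_imfset_le (T K : choiceType) key (f : T -> K) (p : finmempred T)
    (s : seq T) :
  {subset p <= s} -> #|` imfset key f p| <= size s.
Proof.
move=> ps; apply: leq_trans (leq_imfset_card _ _ _) _.
by apply: uniq_leq_size; rewrite ?enum_finmem_uniq // => x; rewrite enum_finmemE => /ps.
Qed.

(** One constant serves all levels [p <= pi], because the recursion calls all the
    smaller levels; successors of [m] and [n] keep the bound positive for
    restricted matrices without rows. *)
Lemma card_SA_le (R : realType) pi : exists c, forall p n m (A : 'M[R]_(m, n)),
  p <= pi -> #|` SA p A| <= c * (m.+1 * n.+1) ^ c.
Proof.
elim: pi => [|pi [c IHc]].
  by exists 1 => p n m A; rewrite leqn0 => /eqP->; rewrite cardfs1 mul1n expn1.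
pose c' := 1 + c + 2 ^ pi.+1 + pi.+1.*2.
exists c' => p n m A; set N := m.+1 * n.+1.
have N0 : 0 < N by [].
have mN : m.+1 <= N by rewrite leq_pmulr.
have nN : n.+1 <= N by rewrite leq_pmull.
rewrite leq_eqVlt ltnS => /orP[/eqP->|ppi]; last first.
  apply: leq_trans (IHc _ _ _ A ppi) _; rewrite -/N.
  have cc' : c <= c' by rewrite /c'; lia.
  by apply: leq_mul => //; rewrite leq_pexp2l.
have small (T : finType) (P : pred {set T}) :
    #|T|.+1 <= N -> (forall B, P B -> #|B| <= pi.+1) -> #|P| <= N ^ pi.+1.
  move=> TN Ppi; apply: leq_trans (_ : #|T|.+1 ^ pi.+1 <= _); last first.
    by rewrite leq_exp2r.
  apply: leq_trans (card_small_sets T pi.+1); apply: subset_leq_card.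
  by apply/subsetP=> B PB; rewrite inE; exact: Ppi.
apply: (@leq_trans (N ^ pi.+1 *
   (1 + N ^ pi.+1 * (c * N ^ c) + N ^ pi.+1 * (2 ^ pi.+1 * N)))).
  apply: card_bigfcup_le => [|C _].
    by apply: small; rewrite ?card_ord // => B; rewrite inE.
  apply: card_fsetU_le; first apply: card_fsetU_le; first by rewrite cardfs1.
    apply: card_bigfcup_le => [|J /andP[_ /andP[J0 Jpi]]].
      apply: small; rewrite ?card_ord // => J /andP[_ /andP[_]]; exact: ltnW.
    set B := restrict _ _ _.
    apply: leq_trans (card_imfset_le _ _ (s := SA (pi - #|J|.-1) B) _) _ => //.
    apply: leq_trans (IHc _ _ _ B (leq_subr _ _)) _.
    rewrite leq_mul2l; apply/orP; right; case: (c) => // c1.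
    rewrite leq_exp2r // leq_mul2r; apply/orP; right; rewrite ltnS.
    apply: leq_trans (max_card _) _; rewrite card_ord.
    by apply: leq_trans (max_card _) _; rewrite card_ord.
  apply: card_bigfcup_le => [|H /andP[_ Hpi]].
    by apply: small; rewrite ?card_ord // => H /andP[_].
  apply: card_bigfcup_le => [|I _].
    by rewrite card_powerset leq_exp2l.
  apply: leq_trans (card_imfset_le _ _ (s := enum 'I_#|overlap A C|.+1) _) _.
    by move=> k _; rewrite mem_enum.
  rewrite -cardE card_ord; apply: leq_trans nN; rewrite ltnS.
  by apply: leq_trans (max_card _) _; rewrite card_ord.
have expN k l : k <= l -> N ^ k <= N ^ l by move=> kl; rewrite leq_pexp2l.
apply: (@leq_trans (N ^ pi.+1 * ((1 + c + 2 ^ pi.+1) * N ^ (pi.+1 + c + 1)))).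
  rewrite leq_mul2l; apply/orP; right; rewrite !mulnDl mul1n.
  apply: leq_add; first apply: leq_add.
  - by rewrite expn_gt0 N0.
  - by rewrite mulnCA -expnD leq_mul2l expN ?orbT //; lia.
  - by rewrite mulnCA -expnSr leq_mul2l expN ?orbT //; lia.
rewrite mulnCA -expnD; apply: leq_mul; first by rewrite /c'; lia.
by apply: expN; rewrite /c'; lia.
Qed.

Lemma card_SA_le_mul (R : realType) pi : exists c, forall m n (A : 'M[R]_(m, n)),
  1 <= m -> 1 <= n -> #|` SA pi A| <= c * (m * n) ^ c.
Proof.
have [c cP] := card_SA_le R pi; exists (c * 4 ^ c) => m n A m1 n1.
apply: leq_trans (cP _ _ _ A (leqnn pi)) _.
rewrite -mulnA leq_mul2l; apply/orP; right.
case: (posnP c) => [->|c0]; first by rewrite mul0n !expn0.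
apply: (@leq_trans ((4 * (m * n)) ^ c)).
  by rewrite leq_exp2r //; nia.
rewrite expnMn leq_mul2l leq_pexp2l ?orbT ?muln_gt0 ?m1 //.
by rewrite leq_pmulr // expn_gt0.
Qed.

End Size.

(** * The relaxation satisfies the inequalities of bounded pitch *)

Theorem theorem4p1 (R : realType) (pi : nat) :
  exists c : nat, forall (m n : nat) (A : 'M[R]_(m, n)),
    (1 <= m)%N -> (1 <= n)%N -> zero_one A -> minimal A ->
    (#|` SA pi A|%fset <= c * (m * n) ^ c)%N /\
    (forall (a : 'cV[R]_n) (a0 : R) (p : nat),
       (forall i, 0 <= a i 0) -> valid A a a0 ->
       is_pitch a a0 p -> (p <= pi)%N ->
       forall y : {mpoly R[n]} -> R,
         sos_solution (SA pi A) (cover_constraints A) y ->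
         0 <= \sum_i a i 0 * y 'X_i - a0).
Proof.
have [c cP] := card_SA_le_mul R pi; exists c => m n A m1 n1 A01 _.
split=> [|a a0 p a_ge0 vA pitch ppi y [ylin y1 ysq yc]]; first exact: cP.
have sol : relaxed_solution (SA pi A) (cover_constraints A) y.
  split=> // [q /in_span_mem | q k /in_span_mem]; [exact: ysq | exact: yc].
have acover K : cover A K -> a0 <= \sum_(j in K) a j 0 by exact: valid_cover A01 vA.
have apitch (J : {set 'I_n}) : J \subset [set j | 0 < a j 0] -> (pi <= #|J|)%N ->
    a0 <= \sum_(j in J) a j 0.
  by move=> JP Jpi; exact: pitch_le_sum pitch JP (leq_trans ppi Jpi).
have [_] := certified_pitch A01 a_ge0 acover apitch sol.
have S1 := mem_SA1 pi A.
have X_span i : in_span (products (SA pi A)) 'X_i.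
  apply: in_span_mem; rewrite -[X in X \in _]mlinX.
  by have := mem_products (Some i) S1 S1; rewrite !mulr1.
have one_span : in_span (products (SA pi A)) 1.
  apply: in_span_mem; rewrite -[X in X \in _]mlin1.
  by have := mem_products None S1 S1; rewrite !mulr1.
have -> : interpolant (fun K => \sum_(j in K) a j 0 - a0) =
    (- a0) *: 1 + \sum_j a j 0 *: 'X_j :> {mpoly R[n]}.
  rewrite -mlin1; under [X in _ + X]eq_bigr do rewrite -mlinX.
  rewrite -mlin_sum -mlin_comb mlinE; apply: eq_interpolant => K.
  rewrite /cube_eval mevalD mevalZ meval1 mulr1 addrC; congr (_ + _).
  rewrite -/(cube_eval _ K) cube_eval_sum big_mkcond; apply: eq_bigr => j _.
  by rewrite cube_evalZ cube_evalX; case: (j \in K); rewrite ?mulr1 ?mulr0.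
rewrite ylin // ?y1 ?(linear_on_span_sum ylin) //.
  by rewrite mulr1 addrC.
apply: in_span_sum => j _.
rewrite -[_ *: _]addr0; apply: in_span_comb => //; exact: in_span0.
Qed.
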